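(* Let $(X,\to,{}^*,1)$ be a quantum-Wajsberg algebra such that $X$ is a self distributive BE algebra, i.e. $x\to(y\to z)=(x\to y)\to(x\to z)$ for all $x,y,z\in X$. Then the quantum-MV algebra $(X,\odot,{}^*,1)$, where $x\odot y:=(x\to y^* )^*$, is an MV algebra.
   Context: A BE algebra is an algebra $(X,\to,1)$ of type $(2,0)$ such that for all $x,y,z\in X$: $x\to x=1$; $x\to 1=1$; $1\to x=x$; $x\to(y\to z)=y\to(x\to z)$. Write $x\le y$ iff $x\to y=1$. It is bounded if there is $0\in X$ with $0\le x$ for all $x$; then $x^*:=x\to 0$. A bounded BE algebra is involutive if $x^{**}=x$ for all $x$; it is then written $(X,\to,{}^*,1)$, with $0=1^*$. In an involutive BE algebra put $x\vee y:=(x\to y)\to y$ and $x\wedge y:=(x^*\vee y^* )^*=((x^*\to y^* )\to y^* )^*$. A quantum-Wajsberg algebra is an involutive BE algebra satisfying $x\to ((x\wedge y)\wedge (z\wedge x))=(x\to y)\wedge (x\to z)$ for all $x,y,z\in X$. An involutive left-m-BE algebra is an algebra $(X,\odot,{}^*,1)$ of type $(2,1,0)$ such that, with $0:=1^*$, for all $x,y,z\in X$: $1\odot x=x=x\odot 1$; $x\odot y=y\odot x$; $x\odot(y\odot z)=(x\odot y)\odot z$; $x\odot 0=0$; $x\odot x^*=0$; $x^{**}=x$. In it put $x\wedge_m^M y:=(x^*\odot y)^*\odot y$ and $x\vee_m^M y:=(x^*\wedge_m^M y^* )^*$. A (left-)quantum-MV algebra is an involutive left-m-BE algebra satisfying $x\odot((x^*\vee_m^M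 y)\vee_m^M(z\vee_m^M x^* ))=(x\odot y)\vee_m^M(x\odot z)$ for all $x,y,z\in X$. A (left-)MV algebra is an involutive left-m-BE algebra satisfying $(x^*\odot y)^*\odot y=(y^*\odot x)^*\odot x$ for all $x,y\in X$. *)

(* Defs.v *)
(* Algebras are given by a carrier [X : Type] with explicit operations;
   equations are Leibniz equalities. *)
Set Implicit Arguments.
Unset Strict Implicit.
Unset Printing Implicit Defensive.

Section BE.

Variable X : Type.

Record BE_algebra (arr : X -> X -> X) (one : X) : Prop := {
  BE_refl : forall x, arr x x = one;
  BE_top : forall x, arr x one = one;
  BE_unit : forall x, arr one x = x;
  BE_exchange : forall x y z, arr x (arr y z) = arr y (arr x z)
}.

Definition BE_le (arr : X -> X -> X) (one : X) (x y : X) : Prop :=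
  arr x y = one.

Record bounded_BE_algebra (arr : X -> X -> X) (one zero : X) : Prop := {
  bounded_BE : BE_algebra arr one;
  bounded_zero_le : forall x, BE_le arr one zero x
}.

(* In the signature (arr, star, one) the bottom element is [star one]. *)
Record involutive_BE_algebra (arr : X -> X -> X) (star : X -> X) (one : X)
    : Prop := {
  inv_bounded : bounded_BE_algebra arr one (star one);
  inv_starE : forall x, star x = arr x (star one);
  inv_starK : forall x, star (star x) = x
}.

Definition BE_join (arr : X -> X -> X) (x y : X) : X := arr (arr x y) y.

Definition BE_meet (arr : X -> X -> X) (star : X -> X) (x y : X) : X :=
  star (BE_join arr (star x) (star y)).

Record quantum_Wajsberg_algebra (arr : X -> X -> X) (star : X -> X) (one : X)
    : Prop := {
  QW_involutive : involutive_BE_algebra arr star one;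
  QW_axiom : forall x y z,
    arr x (BE_meet arr star (BE_meet arr star x y) (BE_meet arr star z x))
    = BE_meet arr star (arr x y) (arr x z)
}.

Record self_distributive_BE_algebra (arr : X -> X -> X) (one : X) : Prop := {
  selfdist_BE : BE_algebra arr one;
  selfdist : forall x y z, arr x (arr y z) = arr (arr x y) (arr x z)
}.

End BE.

Section MBE.

Variable X : Type.

Record involutive_mBE_algebra (mul : X -> X -> X) (star : X -> X) (one : X)
    : Prop := {
  mBE_mul1l : forall x, mul one x = x;
  mBE_mul1r : forall x, mul x one = x;
  mBE_mulC : forall x y, mul x y = mul y x;
  mBE_mulA : forall x y z, mul x (mul y z) = mul (mul x y) z;
  mBE_mul0 : forall x, mul x (star one) = star one;
  mBE_mulstar : forall x, mul x (star x) = star one;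
  mBE_starK : forall x, star (star x) = x
}.

Definition mBE_meet (mul : X -> X -> X) (star : X -> X) (x y : X) : X :=
  mul (star (mul (star x) y)) y.

Definition mBE_join (mul : X -> X -> X) (star : X -> X) (x y : X) : X :=
  star (mBE_meet mul star (star x) (star y)).

Record quantum_MV_algebra (mul : X -> X -> X) (star : X -> X) (one : X)
    : Prop := {
  QMV_involutive : involutive_mBE_algebra mul star one;
  QMV_axiom : forall x y z,
    mul x (mBE_join mul star (mBE_join mul star (star x) y)
                             (mBE_join mul star z (star x)))
    = mBE_join mul star (mul x y) (mul x z)
}.

Record MV_algebra (mul : X -> X -> X) (star : X -> X) (one : X) : Prop := {
  MV_involutive : involutive_mBE_algebra mul star one;
  MV_axiom : forall x y,
    mul (star (mul (star x) y)) y = mul (star (mul (star y) x)) x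
}.

End MBE.

Definition odot (X : Type) (arr : X -> X -> X) (star : X -> X) (x y : X) : X :=
  star (arr x (star y)).

(* Main.v *)
(* Self-distributivity gives y -> (y -> x) = y -> x, and then, writing stars as
   implications into 0, y -> (y -> x)^* = (y -> x) -> (y -> 0) = y -> x^*.
   Hence the meet (x^* . y)^* . y is just x . y, so the MV identity reduces to
   commutativity of the product.  The quantum-MV axiom is the De Morgan dual of the
   quantum-Wajsberg axiom. *)
Require Import Defs.
Set Implicit Arguments.
Unset Strict Implicit.

Section InvolutiveBE.

Variables (X : Type) (arr : X -> X -> X) (star : X -> X) (one : X).
Hypothesis Hinv : involutive_BE_algebra arr star one.

Let HBE : BE_algebra arr one := bounded_BE (inv_bounded Hinv).
Let starK : forall x, star (star x) = x := inv_starK Hinv.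

(** Contraposition is the exchange law once stars are read as implications into [star one]. *)
Lemma arr_star_swap x y : arr x (star y) = arr y (star x).
Proof.
rewrite (inv_starE Hinv x), (inv_starE Hinv y); apply (BE_exchange HBE).
Qed.

Lemma odot_involutive_mBE : involutive_mBE_algebra (odot arr star) star one.
Proof.
split; unfold odot.
- intro x; now rewrite (BE_unit HBE), starK.
- intro x; now rewrite arr_star_swap, (BE_unit HBE), starK.
- intros x y; now rewrite arr_star_swap.
(* Both bracketings reduce to the star of [arr x (arr y (star z))], the right one by contraposition,
   exchange and contraposition again. *)
- intros x y z; rewrite starK, (arr_star_swap (star _) z), starK.
  now rewrite (BE_exchange HBE z), (arr_star_swap z).
- intro x; now rewrite starK, (BE_top HBE).
- intro x; now rewrite starK, (BE_refl HBE).
- exact starK.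
Qed.

Lemma mBE_join_odot x y : mBE_join (odot arr star) star x y = BE_join arr x y.
Proof.
unfold mBE_join, mBE_meet, odot, BE_join.
now rewrite !starK.
Qed.

Lemma star_BE_join x y :
  star (BE_join arr x y) = BE_meet arr star (star x) (star y).
Proof. unfold BE_meet; now rewrite !starK. Qed.

Lemma star_BE_meet x y :
  star (BE_meet arr star x y) = BE_join arr (star x) (star y).
Proof. unfold BE_meet; now rewrite starK. Qed.

Lemma arr_star_arr (Hsd : self_distributive_BE_algebra arr one) x y :
  arr y (star (arr y x)) = arr y (star x).
Proof.
assert (Hcontr : arr y (arr y x) = arr y x).
{ now rewrite (selfdist Hsd y y x), (BE_refl HBE), (BE_unit HBE). }
rewrite (inv_starE Hinv (arr y x)), (inv_starE Hinv x).
now rewrite !(selfdist Hsd y _ (star one)), Hcontr.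
Qed.

Lemma mBE_meet_odot (Hsd : self_distributive_BE_algebra arr one) x y :
  mBE_meet (odot arr star) star x y = odot arr star x y.
Proof.
unfold mBE_meet, odot.
rewrite starK, (arr_star_swap (star x) y), starK.
(* What remains on the left is the star of [arr (arr y x) (star y)]; contraposition moves [y] in
   front, where [arr_star_arr] absorbs the inner [y]. *)
now rewrite arr_star_swap, (arr_star_arr Hsd), arr_star_swap.
Qed.

End InvolutiveBE.

Lemma odot_quantum_MV (X : Type) (arr : X -> X -> X) (star : X -> X) (one : X) :
  quantum_Wajsberg_algebra arr star one ->
  quantum_MV_algebra (odot arr star) star one.
Proof.
intros [Hinv Hax]; split; [exact (odot_involutive_mBE Hinv)|].
intros x y z; rewrite !(mBE_join_odot Hinv); unfold odot.
(* Pushing the star through the joins exposes the quantum-Wajsberg axiom at [x], [star y],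
   [star z]. *)
rewrite !(star_BE_join Hinv), (inv_starK Hinv), Hax.
apply (star_BE_meet Hinv).
Qed.

Theorem proposition5p10 (X : Type) (arr : X -> X -> X) (star : X -> X) (one : X)
    (HQW : quantum_Wajsberg_algebra arr star one)
    (Hsd : self_distributive_BE_algebra arr one) :
  quantum_MV_algebra (odot arr star) star one /\
  MV_algebra (odot arr star) star one.
Proof.
pose proof (QW_involutive HQW) as Hinv.
split; [exact (odot_quantum_MV HQW)|].
split; [exact (odot_involutive_mBE Hinv)|].
intros x y.
change (mBE_meet (odot arr star) star x y = mBE_meet (odot arr star) star y x).
rewrite !(mBE_meet_odot Hinv Hsd).
apply (mBE_mulC (odot_involutive_mBE Hinv)).
Qed.
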